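(* Let $\phi:(\Omega',\mathcal F',\mu')\to(\Omega,\mathcal F,\mu)$ be a measure-preserving map between probability spaces and let $h:\Omega^2\to[0,1]$ be a kernel on $\Omega$. Define the pullback kernel $h^\phi(x,y):=h(\phi(x),\phi(y))$ for $x,y\in\Omega'$. Then for every digraph $D$, $$U_D(h^\phi)=U_D(h).$$
   Context: A digraph is a finite directed simple loopless graph: at most one arc for each ordered pair of distinct vertices (opposite arcs are allowed). A kernel on a probability space $(\Omega,\mathcal F,\mu)$ is a measurable function $h:\Omega^2\to[0,1]$ (not necessarily symmetric). For a finite digraph $D$ with vertex set $\{v_1,\dots,v_n\}$ and arc set $E(D)$, $$U_D(h):=\int_{\Omega^n}\prod_{(v_i,v_j)\in E(D)}h(x_i,x_j)\,d\mu(x_1)\cdots d\mu(x_n);$$ $U_D(h^\phi)$ is computed on $(\Omega',\mathcal F',\mu')$ and $U_D(h)$ on $(\Omega,\mathcal F,\mu)$. *)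

(* Defs.v *)
From HB Require Import structures.
From mathcomp Require Import all_boot all_order all_algebra.
From mathcomp Require Import all_classical all_reals all_analysis.
Import Order.TTheory GRing.Theory Num.Theory.
Import numFieldNormedType.Exports.

Set Implicit Arguments.
Unset Strict Implicit.
Unset Printing Implicit Defensive.

Local Open Scope classical_set_scope.
Local Open Scope ring_scope.

(** The product measure on [n.-tuple T], whose canonical sigma-algebra is
    generated by the [tnth] projections; see [power_probability_box]. *)
Section power_probability.
Context d (T : measurableType d) (R : realType) (mu : probability T R).

Definition tuple_cons n (p : T * n.-tuple T) : n.+1.-tuple T :=
  [tuple of p.1 :: p.2].

Lemma measurable_tuple_cons n :
  measurable_fun [set: T * n.-tuple T] (@tuple_cons n).
Proof. exact: measurable_cons. Qed.

HB.instance Definition _ n :=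
  isMeasurableFun.Build _ _ _ _ (@tuple_cons n) (@measurable_tuple_cons n).

(** [distribution P X] is the image of [P] under [X]: the measure on [T^n.+1]
    is [mu \x mu^n] transported along [T * T^n -> T^n.+1]. *)
Fixpoint power_probability n : probability (n.-tuple T) R :=
  match n with
  | 0 => dirac [tuple]
  | m.+1 => distribution (mu \x power_probability m)%E (@tuple_cons m)
  end.

Lemma power_probability_box n (A : 'I_n -> set T) :
  (forall i, measurable (A i)) ->
  power_probability n [set x | forall i, A i (tnth x i)] =
  (\prod_(i < n) mu (A i))%E.
Proof.
elim: n A => [|n IHn] A mA.
  by rewrite big_ord0 /= diracE mem_set//= => -[].
rewrite big_ord_recl -IHn// /= /distribution /pushforward.
have mB : measurable
    [set x : n.-tuple T | forall i, A (lift ord0 i) (tnth x i)].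
  rewrite [X in measurable X](_ : _ =
      \big[setI/setT]_(i < n) ((@tnth _ T ^~ i) @^-1` A (lift ord0 i))).
    apply: bigsetI_measurable => i _; rewrite -[X in measurable X]setTI.
    exact: measurable_tnth.
  apply/seteqP; split => x /=.
    move=> h; elim/big_ind: _ => //= B C; exact: conj.
  by move=> h i; move: h; rewrite (bigD1 i)//= => -[].
rewrite -product_measure1E//; congr (_ _); apply/seteqP; split => -[a x] /=.
  move=> h; split; first exact: (h ord0).
  by move=> i; have := h (lift ord0 i); rewrite /tuple_cons tnthS.
move=> [Aa Ax] i; have [j ->|->//] := unliftP ord0 i.
by rewrite /tuple_cons tnthS.
Qed.

End power_probability.

Record digraph := Digraph {
  vertex : finType;
  arc : rel vertex;
  arc_irreflexive : irreflexive arc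
}.

Definition is_kernel d (T : measurableType d) (R : realType) (h : T * T -> R) :=
  measurable_fun [set: T * T] h /\ forall p, 0 <= h p <= 1.

Definition measure_preserving d' d (T' : measurableType d')
    (T : measurableType d) (R : realType)
    (mu' : probability T' R) (mu : probability T R) (phi : T' -> T) :=
  measurable_fun [set: T'] phi /\
  forall A : set T, measurable A -> mu' (phi @^-1` A) = mu A.

Definition pullback (R T' T : Type) (phi : T' -> T) (h : T * T -> R) :
    T' * T' -> R :=
  fun p => h (phi p.1, phi p.2).

(** The vertices are enumerated as [v_1, ..., v_n] by [enum_rank], so that the
    variable attached to the vertex [u] is coordinate [enum_rank u]. The value
    is an extended real because that is the type of the Lebesgue integral. *)
Definition U (D : digraph) d (T : measurableType d) (R : realType)
    (mu : probability T R) (h : T * T -> R) : \bar R :=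
  (\int[power_probability mu #|vertex D|]_x
    (\prod_(e : vertex D * vertex D | arc e.1 e.2)
      h (tnth x (enum_rank e.1), tnth x (enum_rank e.2)))%:E)%E.

Lemma is_kernel_pullback d' d (T' : measurableType d') (T : measurableType d)
    (R : realType) (phi : T' -> T) (h : T * T -> R) :
  measurable_fun [set: T'] phi -> is_kernel h -> is_kernel (pullback phi h).
Proof.
move=> mphi [mh h01]; split => [|p]; last exact: h01.
apply: (measurableT_comp mh); apply/measurable_fun_pairP; split.
  exact: (measurableT_comp mphi measurable_fst).
exact: (measurableT_comp mphi measurable_snd).
Qed.

(* Main.v *)
Require Import Defs.
From mathcomp Require Import all_boot all_order all_algebra.
From mathcomp Require Import all_classical all_reals all_analysis.
From mathcomp Require Import measurable_realfun.
Import Num.Theory.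

(** The coordinatewise action of [phi] on tuples carries the power measure of
    [mu'] to that of [mu], and the integrand of [U] for the pullback kernel is
    the integrand for [h] composed with this action; the theorem is the change
    of variables along it.

    The transport of power measures is shown on integrals of nonnegative
    functions ([integral_power_probability_map]), by induction on the number
    of coordinates. Tonelli's theorem peels off the first coordinate, the
    induction hypothesis replaces the inner integral over the remaining ones,
    and what is left is a measurable function of [phi] of the first
    coordinate, to which the one-variable change of variables applies. *)

Local Open Scope classical_set_scope.
Local Open Scope ring_scope.

Lemma ge0_integral_measure_preserving (R : realType) (d' d : measure_display)
    (T' : measurableType d') (T : measurableType d)
    (mu' : probability T' R) (mu : probability T R) (phi : T' -> T)
    (f : T -> \bar R) :
  measure_preserving mu' mu phi -> measurable_fun [set: T] f ->
  (forall x, 0 <= f x)%E ->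
  (\int[mu']_x f (phi x) = \int[mu]_x f x)%E.
Proof.
move=> [mphi muE] mf f0.
rewrite -[LHS](ge0_integral_pushforward mphi mu' measurableT mf)//.
by apply: eq_measure_integral => A mA _; exact: muE.
Qed.

Lemma measurable_map_tuple (d' d : measure_display)
    (T' : measurableType d') (T : measurableType d) (phi : T' -> T) (n : nat) :
  measurable_fun [set: T'] phi ->
  measurable_fun [set: n.-tuple T'] (fun x => map_tuple phi x).
Proof.
move=> mphi; apply/measurable_fun_tnthP => i.
rewrite (_ : _ \o _ = phi \o (fun x : n.-tuple T' => tnth x i)).
  exact: measurableT_comp mphi (measurable_tnth i).
by apply/funext => x /=; rewrite tnth_map.
Qed.

Lemma integral_power_probability_cons (R : realType) (d : measure_display)
    (T : measurableType d) (mu : probability T R) (n : nat)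
    (f : n.+1.-tuple T -> \bar R) :
  measurable_fun [set: n.+1.-tuple T] f -> (forall x, 0 <= f x)%E ->
  (\int[power_probability mu n.+1]_x f x =
   \int[mu]_a \int[power_probability mu n]_x f (tuple_cons (a, x)))%E.
Proof.
move=> mf f0; rewrite /= ge0_integral_distribution// fubini_tonelli1//=.
exact: measurableT_comp mf (@measurable_tuple_cons _ _ n).
Qed.

(** Stating the transport on integrals rather than on measures of sets lets
    the induction hypothesis be used directly under the integral over the first
    coordinate, with that coordinate fixed; nonnegativity is what Tonelli's
    theorem asks for. *)
Lemma integral_power_probability_map (R : realType) (d' d : measure_display)
    (T' : measurableType d') (T : measurableType d)
    (mu' : probability T' R) (mu : probability T R) (phi : T' -> T)
    (n : nat) (f : n.-tuple T -> \bar R) :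
  measure_preserving mu' mu phi ->
  measurable_fun [set: n.-tuple T] f -> (forall x, 0 <= f x)%E ->
  (\int[power_probability mu' n]_x f (map_tuple phi x) =
   \int[power_probability mu n]_x f x)%E.
Proof.
move=> mp; have [mphi _] := mp.
elim: n f => [|n IHn] f mf f0.
  (* There is a single 0-tuple, so every function on 0-tuples is constant. *)
  have mT0 (g : 0.-tuple T' -> \bar R) : measurable_fun setT g.
    rewrite (_ : g = cst (g [tuple]))//.
    by apply/funext => x; rewrite (tuple0 x).
  by rewrite /= !integral_dirac// !diracT !mul1e (tuple0 (map_tuple _ _)).
have mfc : measurable_fun [set: T * n.-tuple T] (f \o @tuple_cons _ T n).
  exact: measurableT_comp mf (@measurable_tuple_cons _ _ n).
rewrite !integral_power_probability_cons//; last first.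
  exact: measurableT_comp mf (@measurable_map_tuple _ _ _ _ _ n.+1 mphi).
(* The inner integral over the other coordinates is, by Tonelli, a measurable
   function of the first coordinate. *)
rewrite -(ge0_integral_measure_preserving _ _ _ _ _ _ _ _ _ mp); last 2 first.
- exact: (measurable_fun_fubini_tonelli_F _ mfc (fun p => f0 (tuple_cons p))).
- by move=> a; exact: integral_ge0.
apply: eq_integral => a _.
rewrite -(IHn (fun x => f (tuple_cons (phi a, x))))//; last first.
  exact: measurableT_comp mfc (pair1_measurable (phi a)).
apply: eq_integral => x _.
by congr f; apply: val_inj.
Qed.

Lemma measurable_U_integrand (R : realType) (d : measure_display)
    (T : measurableType d) (h : T * T -> R) (D : digraph) :
  measurable_fun [set: T * T] h ->
  measurable_fun [set: #|vertex D|.-tuple T]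
    (fun x => (\prod_(e : vertex D * vertex D | Defs.arc e.1 e.2)
      h (tnth x (enum_rank e.1), tnth x (enum_rank e.2)))%:E).
Proof.
move=> mh; apply/measurable_EFinP.
under eq_fun do rewrite -big_filter.
apply: measurable_prod => e _; apply: (measurableT_comp mh).
by apply: measurable_fun_pair; exact: measurable_tnth.
Qed.

Theorem lemmaB3 (R : realType) (d' d : measure_display)
    (Omega' : measurableType d') (Omega : measurableType d)
    (mu' : probability Omega' R) (mu : probability Omega R)
    (phi : Omega' -> Omega) (h : Omega * Omega -> R)
    (phi_mp : measure_preserving mu' mu phi) (h_kernel : is_kernel h)
    (D : digraph) :
  U D mu' (pullback phi h) = U D mu h.
Proof.
have [mh h01] := h_kernel.
rewrite /U -(integral_power_probability_map _ _ _ _ _ _ _ _ _ _ phi_mp).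
- apply: eq_integral => x _; congr EFin; apply: eq_bigr => e _.
  by rewrite /pullback !tnth_map.
- exact: measurable_U_integrand.
- move=> x; rewrite lee_fin; apply: prodr_ge0 => e _.
  by have /andP[] := h01 (tnth x (enum_rank e.1), tnth x (enum_rank e.2)).
Qed.
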